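(* Let $\mathbb{N}$ denote the positive integers. There exists a function $N:\mathbb{N}^2\to\mathbb{N}$ such that for all positive integers $k,m$, every $n\ge N(k,m)$, and any collection $f_1,\ldots,f_m$ of $m$ odd functions $S^{n-1}\times S^{n-1}\to\mathbb{R}$, there exists an orthonormal $k$-frame $(e_1,\ldots,e_k)$ in $\mathbb{R}^n$ such that for all $1\le l\le m$ and $1\le i<j\le k$ $$f_l(e_i,e_j)=0\quad\text{and}\quad f_l(e_1,e_1)=\cdots=f_l(e_k,e_k).$$
   Context: A continuous function $f:S^{n-1}\times S^{n-1}\to\mathbb{R}$ is called odd if $f(-x,y)=-f(x,y)$ and $f(x,-y)=-f(x,y)$ for all $x,y\in S^{n-1}$. *)

(* Defs.v *)
From HB Require Import structures.
From mathcomp Require Export all_boot all_order all_algebra.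
From mathcomp Require Export boolp classical_sets reals topology normedtype.

Set Implicit Arguments.
Unset Strict Implicit.
Unset Printing Implicit Defensive.

Import Order.TTheory GRing.Theory Num.Theory.
Import numFieldNormedType.Exports.

Local Open Scope classical_set_scope.
Local Open Scope ring_scope.

Definition dotp (R : realType) (n : nat) (x y : 'rV[R]_n) : R :=
  \sum_(i < n) x 0 i * y 0 i.

(* The library norm `|x| on 'rV[R]_n is the sup norm; it induces the same
   topology but not the same unit sphere. *)
Definition enorm (R : realType) (n : nat) (x : 'rV[R]_n) : R :=
  Num.sqrt (dotp x x).

(* Indexed by the ambient dimension: S^(n-1) in R^n. *)
Definition sphere (R : realType) (n : nat) : set 'rV[R]_n :=
  [set x | enorm x = 1].

(* A function on S^(n-1) x S^(n-1) is represented by a total function on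
   R^n x R^n, whose values off the product of spheres are irrelevant. *)
Definition odd_bifun (R : realType) (n : nat)
    (f : 'rV[R]_n * 'rV[R]_n -> R) : Prop :=
  [/\ {within @sphere R n `*` @sphere R n, continuous f},
      forall x y, sphere x -> sphere y -> f (- x, y) = - f (x, y) &
      forall x y, sphere x -> sphere y -> f (x, - y) = - f (x, y)].

Definition orthonormal_frame (R : realType) (k n : nat)
    (e : 'I_k -> 'rV[R]_n) : Prop :=
  forall i j, dotp (e i) (e j) = (i == j)%:R.

(* Main.v *)
Require Import Defs.
From mathcomp Require Import sequences realfun zify ring lra.

Set Implicit Arguments.
Unset Strict Implicit.
Unset Printing Implicit Defensive.

Import Order.TTheory GRing.Theory Num.Theory.
Import numFieldNormedType.Exports.

Local Open Scope classical_set_scope.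
Local Open Scope ring_scope.

(** The off-diagonal conditions are odd in each vector of the frame and can be
    solved by the Borsuk-Ulam theorem; the diagonal ones are even, and no
    Borsuk-Ulam argument applies to them directly. They are dealt with first,
    by fixing the common value of the functions [x |-> f_l (x, x)] and keeping
    only the vectors that realise it.

    Say that a set [A] of nonzero vectors has genus at most [D] if some [D] odd
    continuous functions have no common zero on [A] ([genus_le]). If [g] is even
    and every fibre of [g] in a compact set [A] has genus at most [D], then [A]
    has genus at most [D + D] ([genus_le_double]). Indeed, by compactness the
    functions attached to a fibre still have no common zero on a thin slab
    around it. Finitely many slabs of a fixed width centred at equally spaced
    values of [g] cover [A], and slabs whose indices have the same parity are
    disjoint; so bump functions of [g], which are even, glue the functions of
    the even slabs into [D] odd functions and those of the odd slabs into
    another [D].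

    By Borsuk-Ulam the unit sphere of [R^n] does not have genus at most [D] if
    [D < n]. Applying the previous fact to [m] functions in turn, for
    [n > 2 ^ m * (k * (m + 1))] some common fibre [A] of the functions
    [x |-> f_l (x, x)] on the sphere does not have genus at most
    [k * (m + 1)]. The frame is chosen inside [A], one vector after another:
    the next vector has to be a common zero in [A] of the odd functions
    [y |-> <e_i, y>] and [y |-> f_l (e_i, y)] for the vectors [e_i] already chosen, and
    there are at most [k * (m + 1)] of these ([orthogonal_zeros]).

    The Borsuk-Ulam theorem ([borsuk_ulam]) is proved with mod 2 chains of
    simplices, a simplex being the sequence of its vertices. Let [c_i] be the
    upper hemisphere of the octahedral [i]-sphere, so that the boundary of
    [c_(i+1)] is [c_i] plus its antipode, and subdivide barycentrically, which
    preserves this relation. For odd functions [h_0, h_1, ...] let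
    [B (x_0, ..., x_i)] say that [h_j] changes sign between [x_j] and
    [x_(j+1)] for every [j < i]: this is the cup product of the coboundaries
    of the signs of the [h_j]. If the last factor is replaced by the sign
    itself, one gets a cochain with coboundary [B]; by Stokes and oddness, the
    number of simplices of [c_(i+1)] satisfying [B] has the same parity as
    that of [c_i], hence is odd like that of the single point [c_0]
    ([parity_all_change]). So there are arbitrarily small simplices on which
    all the [h_j] change sign, and compactness gives a common zero. *)

(** * Chains modulo 2 *)

(** A chain is a list, read modulo 2: it only matters through the parities with
    which cochains, that is boolean predicates, hold on it. *)
Definition parity (T : Type) (phi : pred T) (c : seq T) : bool :=
  odd (count phi c).

Definition chain_eq (T : Type) (c d : seq T) : Prop :=
  forall phi : pred T, parity phi c = parity phi d.

Definition linear_extension (S T : Type) (F : S -> seq T) (c : seq S) : seq T :=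
  flatten (map F c).

Section Parity.
Variable T : Type.
Implicit Types (phi psi : pred T) (c d : seq T).

Lemma parity_cons phi s c : parity phi (s :: c) = phi s (+) parity phi c.
Proof. by rewrite /parity /= oddD oddb. Qed.

Lemma parity_cat phi c d : parity phi (c ++ d) = parity phi c (+) parity phi d.
Proof. by rewrite /parity count_cat oddD. Qed.

Lemma parity_map S (f : S -> T) phi (c : seq S) :
  parity phi (map f c) = parity (fun s => phi (f s)) c.
Proof. by rewrite /parity count_map. Qed.

Lemma parity_addb phi psi c :
  parity (fun s => phi s (+) psi s) c = parity phi c (+) parity psi c.
Proof.
elim: c => [//|s c IH]; rewrite !parity_cons IH.
by rewrite -!addbA; congr addb; rewrite addbCA.
Qed.

Lemma parity_andl b phi c : parity (fun s => b && phi s) c = b && parity phi c.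
Proof.
elim: c => [|s c IH]; first by rewrite andbF.
by rewrite !parity_cons IH andb_addr.
Qed.

End Parity.

Lemma parity_linear S T (F : S -> seq T) (phi : pred T) c :
  parity phi (linear_extension F c) = parity (fun s => parity phi (F s)) c.
Proof.
elim: c => [//|s c IH].
by rewrite /linear_extension /= parity_cat parity_cons -/(linear_extension _ _) IH.
Qed.

Lemma eq_parity_in (T : eqType) (phi psi : pred T) c :
  {in c, phi =1 psi} -> parity phi c = parity psi c.
Proof. by move=> e; congr odd; exact: eq_in_count. Qed.

Lemma eq_parity (T : Type) (phi psi : pred T) (c : seq T) :
  phi =1 psi -> parity phi c = parity psi c.
Proof. by move=> e; congr odd; exact: eq_count. Qed.

(** * Simplices as tuples of points *)

Section Boundary.
Variable T : eqType.
Implicit Types (s t : seq T) (c d : seq (seq T)).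

(** The facet of a point is the empty simplex: the complex is augmented, so that
    the boundary of a cone needs no special case in dimension 0. *)
Fixpoint facets s : seq (seq T) :=
  if s is x :: s' then s' :: map (cons x) (facets s') else [::].

Definition boundary c := linear_extension facets c.

Definition cone (b : T) c := map (cons b) c.

Lemma facets_cons x s : facets (x :: s) = s :: map (cons x) (facets s).
Proof. by []. Qed.

Lemma size_facets s t : t \in facets s -> (size t).+1 = size s.
Proof.
elim: s t => [//|x s IH] t /=; rewrite inE => /orP[/eqP -> //|].
by case/mapP => u us ->; rewrite /= (IH _ us).
Qed.

Lemma mem_facets s t : t \in facets s -> {subset t <= s}.
Proof.
elim: s t => [//|x s IH] t /=; rewrite inE => /orP[/eqP -> |].
  by move=> y; rewrite inE orbC => ->.
case/mapP => u us -> y; rewrite !inE; case: (y == x) => //=.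
exact: IH us y.
Qed.

Lemma parity_boundary_cone phi b c :
  parity phi (boundary (cone b c)) =
    parity phi c (+) parity phi (cone b (boundary c)).
Proof.
rewrite /boundary parity_linear !parity_map parity_linear -parity_addb.
by apply: eq_parity => s; rewrite /= parity_cons parity_map.
Qed.

Lemma parity_boundary phi c :
  parity phi (boundary c) = parity (fun s => parity phi (facets s)) c.
Proof. exact: parity_linear. Qed.

Lemma parity_boundary_linear S phi (F : S -> seq (seq T)) (c : seq S) :
  parity phi (boundary (linear_extension F c)) =
    parity (fun w => parity phi (boundary (F w))) c.
Proof.
rewrite parity_boundary parity_linear.
by apply: eq_parity => u; rewrite parity_boundary.
Qed.

(** By induction, as a simplex is the cone from its first vertex over its first
    facet. *)
Lemma parity_boundary_facets phi s : parity phi (boundary (facets s)) = false.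
Proof.
elim: s phi => [//|x s IH] phi.
rewrite /= /boundary /linear_extension /= parity_cat.
rewrite -/(linear_extension facets _) -/(boundary _) -/(cone x _).
by rewrite parity_boundary_cone addbA addbb /= parity_map IH.
Qed.

End Boundary.

(** * Sign changes along a simplex *)

Section SignCochain.
Variables (T : eqType) (a : nat -> pred T).

(** The cup product of the coboundaries of the 0-cochains [a i], [a i.+1], ... *)
Fixpoint all_change (i : nat) (s : seq T) : bool :=
  if s is x :: s' then
    if s' is y :: _ then (a i x != a i y) && all_change i.+1 s' else true
  else true.

(** The same cup product with its last factor replaced by the 0-cochain itself,
    of which [all_change] is the coboundary. *)
Fixpoint change_then_pos (i : nat) (s : seq T) : bool :=
  if s is x :: s' then
    if s' is y :: _ then (a i x != a i y) && change_then_pos i.+1 s' else a i x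
  else false.

Lemma all_change_cons2 i x y s :
  all_change i [:: x, y & s] = (a i x != a i y) && all_change i.+1 (y :: s).
Proof. by []. Qed.

Lemma change_then_pos_cons2 i x y s :
  change_then_pos i [:: x, y & s] =
    (a i x != a i y) && change_then_pos i.+1 (y :: s).
Proof. by []. Qed.

(** Leibniz rule, all factors but the last being cocycles. *)
Lemma coboundary_change_then_pos i s : (1 < size s)%N ->
  parity (change_then_pos i) (facets s) = all_change i s.
Proof.
elim: s i => [//|x [//|y s] IH] i _; rewrite 2!facets_cons.
case: s IH => [|z s] IH.
  by rewrite /= !parity_cons /=; case: (a i x); case: (a i y).
have := IH i.+1 isT; rewrite facets_cons parity_cons parity_map => {}IH.
rewrite map_cons -map_comp 2!parity_cons parity_map.
have -> // := @eq_parity _ _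
  (fun t => (a i x != a i y) && change_then_pos i.+1 (y :: t)).
rewrite parity_andl; set P := parity _ _ in IH *.
rewrite all_change_cons2 -IH !change_then_pos_cons2.
move: (change_then_pos _ _) P {IH} => G P.
by move: (a i x) (a i y) (a i z) G P => [] [] [] [] [].
Qed.

(** An antipodal map exchanges the two values of each [a j], hence fixes every
    sign change and flips the last factor only. *)
Lemma change_then_pos_antipode (tau : T -> T) i s : s != [::] ->
  {in s, forall x j, a j (tau x) = ~~ a j x} ->
  change_then_pos i s (+) change_then_pos i (map tau s) = all_change i s.
Proof.
elim: s i => [//|x [|y s] IH] i _ h.
  by rewrite /= h ?mem_head //; case: (a i x).
have {}IH := IH i.+1 isT (fun z zs => h z (mem_behead (s := x :: _) zs)).
move: IH => /=; rewrite !h ?inE ?eqxx ?orbT // => <-.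
by case: (a i x); case: (a i y).
Qed.

End SignCochain.

(** * Barycentric subdivision *)

Section Subdivision.
Variables (R : realType) (V : lmodType R).
Implicit Types (s t : seq V) (c d : seq (seq V)).

Definition barycenter s : V := (size s)%:R^-1 *: \sum_(x <- s) x.

(** The only consequence of convexity that matters under subdivision. *)
Definition bary_closed (C : V -> Prop) : Prop :=
  forall s, s != [::] -> {in s, forall x, C x} -> C (barycenter s).

(** The first argument is the number of vertices of the simplex; it makes the
    recursion on the dimension structural. *)
Fixpoint subdivide (n : nat) s : seq (seq V) :=
  if n is n'.+1 then
    cone (barycenter s) (linear_extension (subdivide n') (facets s))
  else [:: s].

Definition subdivide_iter (r n : nat) c :=
  iter r (linear_extension (subdivide n)) c.

Definition antipode s : seq V := map -%R s.

Lemma mem_linear_extension (S T : eqType) (F : S -> seq T) (c : seq S) (t : T) :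
  reflect (exists2 s, s \in c & t \in F s) (t \in linear_extension F c).
Proof. exact: flatten_mapP. Qed.

Lemma size_subdivide n s t : size s = n -> t \in subdivide n s -> size t = n.
Proof.
elim: n s t => [|n IH] s t sz /=; first by rewrite inE => /eqP ->.
case/mapP => u /mem_linear_extension[w ws uw] -> /=; congr S.
by apply: IH uw; apply: succn_inj; rewrite (size_facets ws).
Qed.

Lemma subdivide_bary_closed (C : V -> Prop) n s t :
  bary_closed C -> size s = n -> {in s, forall x, C x} ->
  t \in subdivide n s -> {in t, forall x, C x}.
Proof.
move=> Cb; elim: n s t => [|n IH] s t sz Cs /=; first by rewrite inE => /eqP ->.
case/mapP => u /mem_linear_extension[w ws uw] -> x.
rewrite inE => /orP[/eqP ->|].
  by apply: Cb => //; case: (s) sz.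
apply: (IH w u _ _ uw); first by apply: succn_inj; rewrite (size_facets ws).
by move=> y yw; apply: Cs; exact: mem_facets ws _ yw.
Qed.

(** A subdivided simplex is the cone from its barycenter over its subdivided
    boundary, so by the cone formula it suffices that the latter is a cycle;
    this follows by induction from the fact that the boundary is one. *)
Lemma boundary_subdivide phi n s : size s = n.+1 ->
  parity phi (boundary (subdivide n.+1 s)) =
    parity phi (linear_extension (subdivide n) (facets s)).
Proof.
elim: n phi s => [|n IH] phi s sz.
  by case: s sz => [|x [|y s]].
rewrite [subdivide n.+2 s]/= parity_boundary_cone -[RHS]addbF; congr addb.
rewrite parity_map parity_boundary_linear; set psi := fun u => phi _.
transitivity (parity (fun t => parity psi (subdivide n t)) (boundary (facets s))).
  rewrite parity_boundary; apply: eq_parity_in => t ts.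
  by rewrite IH ?parity_linear //; apply: succn_inj; rewrite (size_facets ts).
exact: parity_boundary_facets.
Qed.

Lemma boundary_subdivide_chain phi n c : {in c, forall s, size s = n.+1} ->
  parity phi (boundary (linear_extension (subdivide n.+1) c)) =
    parity phi (linear_extension (subdivide n) (boundary c)).
Proof.
move=> cz; rewrite parity_boundary_linear parity_linear parity_boundary.
by apply: eq_parity_in => s sc; rewrite boundary_subdivide ?cz // parity_linear.
Qed.

Lemma size_subdivide_iter r n c : {in c, forall s, size s = n} ->
  {in subdivide_iter r n c, forall s, size s = n}.
Proof.
move=> cz; elim: r => [//|r IH] t /mem_linear_extension[s sc ts].
exact: size_subdivide (IH _ sc) ts.
Qed.

Lemma parity_subdivide_iter phi r n c d : chain_eq c d ->
  parity phi (subdivide_iter r n c) = parity phi (subdivide_iter r n d).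
Proof. by move=> e; elim: r phi => [//|r IH] phi; rewrite !parity_linear IH. Qed.

Lemma boundary_subdivide_iter phi r n c : {in c, forall s, size s = n.+1} ->
  parity phi (boundary (subdivide_iter r n.+1 c)) =
    parity phi (subdivide_iter r n (boundary c)).
Proof.
move=> cz; elim: r phi => [//|r IH] phi.
rewrite boundary_subdivide_chain; last exact: size_subdivide_iter.
by rewrite parity_linear IH -parity_linear.
Qed.

Lemma linear_extension_cat (S T : Type) (F : S -> seq T) (c d : seq S) :
  linear_extension F (c ++ d) = linear_extension F c ++ linear_extension F d.
Proof. by rewrite /linear_extension map_cat flatten_cat. Qed.

Lemma subdivide_iter_cat r n c d :
  subdivide_iter r n (c ++ d) = subdivide_iter r n c ++ subdivide_iter r n d.
Proof. by elim: r => [//|r IH] /=; rewrite IH linear_extension_cat. Qed.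

Lemma barycenter_antipode s : barycenter (antipode s) = - barycenter s.
Proof. by rewrite /barycenter /antipode size_map big_map sumrN scalerN. Qed.

Lemma facets_antipode s : facets (antipode s) = map antipode (facets s).
Proof. by elim: s => [//|x s IH] /=; rewrite IH -!map_comp. Qed.

Lemma subdivide_antipode n s :
  subdivide n (antipode s) = map antipode (subdivide n s).
Proof.
elim: n s => [//|n IH] s /=.
rewrite barycenter_antipode facets_antipode /cone.
have cons_antipode b c : map antipode (map (cons b) c) =
    map (cons (- b)) (map antipode c) by rewrite -!map_comp.
rewrite cons_antipode; congr map; rewrite /linear_extension map_flatten -!map_comp; congr flatten.
by apply: eq_map => t /=; rewrite IH.
Qed.

Lemma subdivide_iter_antipode r n c :
  subdivide_iter r n (map antipode c) = map antipode (subdivide_iter r n c).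
Proof.
elim: r => [//|r IH] /=; rewrite IH /linear_extension map_flatten -!map_comp.
by congr flatten; apply: eq_map => t /=; rewrite subdivide_antipode.
Qed.

Variable v : nat -> V.

(** The half of the octahedral sphere spanned by the vectors [v j], [j <= i], on
    which the last coordinate is nonnegative. *)
Fixpoint hemisphere (i : nat) : seq (seq V) :=
  if i is i'.+1 then
    cone (v i) (hemisphere i' ++ map antipode (hemisphere i'))
  else [:: [:: v 0%N]].

Lemma hemisphereS i : hemisphere i.+1 =
  cone (v i.+1) (hemisphere i ++ map antipode (hemisphere i)).
Proof. by []. Qed.

Lemma size_hemisphere i : {in hemisphere i, forall s, size s = i.+1}.
Proof.
elim: i => [|i IH] s /=; first by rewrite inE => /eqP ->.
case/mapP => t; rewrite mem_cat => /orP[th|/mapP[u uh ->]] -> /=.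
  by rewrite IH.
by rewrite size_map IH.
Qed.

Lemma boundary_map_antipode c :
  boundary (map antipode c) = map antipode (boundary c).
Proof.
rewrite /boundary /linear_extension map_flatten -!map_comp; congr flatten.
by apply: eq_map => s /=; rewrite facets_antipode.
Qed.

Lemma antipodeK : involutive antipode.
Proof. by move=> s; rewrite /antipode -map_comp map_id_in // => x _ /=; rewrite opprK. Qed.

(** The base of the cone is the octahedral sphere of dimension [i], which is a
    cycle because the boundary of each half is the sphere of dimension
    [i - 1]. *)
Lemma boundary_hemisphere i :
  chain_eq (boundary (hemisphere i.+1))
    (hemisphere i ++ map antipode (hemisphere i)).
Proof.
elim: i => [|i IH] phi; rewrite hemisphereS;
  rewrite parity_boundary_cone -[RHS]addbF; congr addb;
  rewrite parity_map /boundary linear_extension_cat -!/(boundary _) parity_cat;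
  rewrite boundary_map_antipode parity_map.
  by rewrite /= !parity_cons /= addbF addbb.
rewrite !IH !parity_cat !parity_map addbA addbK.
rewrite (@eq_parity _ _ (fun s => phi (v i.+2 :: s))) ?addbb // => s /=.
by rewrite antipodeK.
Qed.
End Subdivision.

(** * Small simplices along which every sign changes *)

Section SmallSignChange.
Variables (R : realType) (V : normedModType R) (v : nat -> V).
Implicit Types (s t : seq V) (c d : seq (seq V)).

(** Induction on [i]: [all_change] is a coboundary, so its parity on the upper
    hemisphere is computed on the boundary, made of the hemisphere of lower
    dimension and its antipode; their contributions add up to [all_change]
    there. *)
Lemma parity_all_change (a : nat -> pred V) r i :
  (forall j s, (j <= i)%N -> s \in subdivide_iter r j.+1 (hemisphere v j) ->
    {in s, forall x l, a l (- x) = ~~ a l x}) ->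
  parity (all_change a 0) (subdivide_iter r i.+1 (hemisphere v i)).
Proof.
elim: i => [_|i IH ha].
  suff -> : subdivide_iter r 1 (hemisphere v 0) = [:: [:: v 0%N]] by [].
  elim: r => [//|r IHr]; rewrite [LHS]/= -/(subdivide_iter r 1 _) IHr /=.
  by rewrite /linear_extension /= /barycenter /= big_seq1 invr1 scale1r.
have hz := size_subdivide_iter (r := r) (@size_hemisphere _ _ v _).
rewrite -(eq_parity_in (phi := fun s => parity (change_then_pos a 0) (facets s))).
  rewrite -parity_boundary boundary_subdivide_iter; last exact: size_hemisphere.
  rewrite (parity_subdivide_iter _ _ _ (boundary_hemisphere v i)).
  rewrite subdivide_iter_cat subdivide_iter_antipode parity_cat parity_map.
  rewrite -parity_addb -[X in is_true X](@eq_parity_in _ (all_change a 0)).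
    by apply: IH => j s ji; apply: ha; exact: leqW.
  move=> s hs /=; rewrite -(@change_then_pos_antipode _ _ -%R) //.
    by apply: contra_eqN (hz _ _ hs) => /eqP ->.
  exact: ha hs.
by move=> s hs; apply: coboundary_change_then_pos; rewrite (hz _ _ hs).
Qed.

Definition diam_le (e : R) s : Prop := {in s &, forall x y, `|x - y| <= e}.

Lemma sub_barycenter (b : V) s : s != [::] ->
  b - barycenter s = (size s)%:R^-1 *: \sum_(x <- s) (b - x).
Proof.
move=> s0; rewrite sumrB scalerBr; congr (_ - _).
rewrite big_const_seq count_predT iter_addr_0 -[b *+ _]scaler_nat scalerA.
by rewrite mulVf ?scale1r // pnatr_eq0; case: (s) s0.
Qed.

Lemma ball_bary_closed (b : V) (e : R) : bary_closed (fun z => `|b - z| <= e).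
Proof.
move=> s s0 hs; rewrite sub_barycenter //.
have sz : (0 : R) < (size s)%:R by rewrite ltr0n; case: (s) s0.
rewrite normrZ gtr0_norm ?invr_gt0 // ler_pdivrMl //.
rewrite (le_trans (ler_norm_sum _ _ _)) // mulr_natl.
rewrite -(count_predT s) -iter_addr_0 -big_const_seq.
by rewrite big_seq [X in _ <= X]big_seq; apply: ler_sum => x; exact: hs.
Qed.

(** One of the differences that are averaged vanishes, whence a factor smaller
    than 1. *)
Lemma barycenter_dist (e : R) s x : diam_le e s -> x \in s ->
  `|barycenter s - x| <= (size s).-1%:R / (size s)%:R * e.
Proof.
move=> hs xs; have sz : (0 : R) < (size s)%:R by rewrite ltr0n; case: (s) xs.
rewrite distrC sub_barycenter; last by case: (s) xs.
rewrite normrZ gtr0_norm ?invr_gt0 // mulrAC [_ / _]mulrC ler_pM2l ?invr_gt0 //.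
rewrite (perm_big _ (perm_to_rem xs)) /= big_cons subrr add0r.
rewrite (le_trans (ler_norm_sum _ _ _)) // mulr_natl -(size_rem xs).
rewrite -(count_predT (rem x s)) -iter_addr_0 -big_const_seq.
rewrite big_seq [X in _ <= X]big_seq; apply: ler_sum => y /mem_rem ys; exact: hs.
Qed.

(** Two vertices of a new simplex either lie in a subdivided facet, or one of
    them is the barycenter, and balls around it are convex. *)
Lemma diam_subdivide (e q : R) n s t : 0 <= e -> 0 <= q ->
  (forall p, (p < n)%N -> p%:R / p.+1%:R <= q) ->
  size s = n -> diam_le e s -> t \in subdivide n s ->
  (0 < n)%N -> diam_le (q * e) t.
Proof.
move=> e0 q0; elim: n s t => [//|n IH] s t qn sz hs /= /mapP[u].
move=> /mem_linear_extension[w ws uw] -> _.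
have wz : size w = n by apply: succn_inj; rewrite (size_facets ws).
have bu : {in u, forall y, `|barycenter s - y| <= q * e}.
  apply: subdivide_bary_closed (@ball_bary_closed _ _) wz _ uw => y yw.
  rewrite (le_trans (barycenter_dist hs (mem_facets ws yw))) //.
  by rewrite ler_wpM2r // sz qn.
have uu : diam_le (q * e) u.
  case: n => [|n] in IH qn sz wz uw *.
    by move: uw; rewrite /= inE (size0nil wz) => /eqP ->.
  apply: IH uw _ => // [p pn|x y xw yw]; first by apply: qn; exact: leqW.
  by apply: hs; exact: mem_facets ws _ _.
move=> x y; rewrite !inE => /orP[/eqP ->|xu] /orP[/eqP ->|yu].
- by rewrite subrr normr0 mulr_ge0.
- exact: bu.
- by rewrite distrC bu.
- exact: uu.
Qed.

Lemma diam_subdivide_iter (e : R) r n c : 0 <= e -> (0 < n)%N ->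
  {in c, forall s, size s = n} -> (forall s, s \in c -> diam_le e s) ->
  forall s, s \in subdivide_iter r n c -> diam_le ((n.-1%:R / n%:R) ^+ r * e) s.
Proof.
move=> e0 n0 cz hc; elim: r => [|r IH] s; first by rewrite mul1r; exact: hc.
move=> /mem_linear_extension[t tr st]; rewrite exprS -mulrA.
apply: diam_subdivide st _ => //.
- by rewrite mulr_ge0 // exprn_ge0 // divr_ge0.
- by rewrite divr_ge0.
- move=> p pn; rewrite ler_pdivrMr ?ltr0n // mulrAC ler_pdivlMr ?ltr0n //.
  rewrite -!natrM ler_nat; nia.
- exact: size_subdivide_iter tr.
- exact: IH.
Qed.

(** The predicate depends on the simplex [s] being subdivided, so that it can say
    that a point satisfies the affine equations satisfied by the vertices of
    [s]. *)
Lemma subdivide_iter_bary_closed (C : seq V -> V -> Prop) r n c t :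
  (forall s, bary_closed (C s)) -> {in c, forall s, size s = n} ->
  (forall s, s \in c -> {in s, forall x, C s x}) ->
  t \in subdivide_iter r n c ->
  exists2 s, s \in c & {in t, forall x, C s x}.
Proof.
move=> Cb cz Cc; elim: r t => [|r IH] t; first by move=> tc; exists t => //; exact: Cc.
move=> /mem_linear_extension[u ur tu]; have [s sc Cu] := IH _ ur.
by exists s => //; apply: subdivide_bary_closed (Cb s) (size_subdivide_iter cz ur) Cu tu.
Qed.

(** The vertices of a simplex of the octahedron lie on distinct axes, so there is
    one sign for each axis. *)
Lemma hemisphere_signs i s : s \in hemisphere v i ->
  exists sigma : nat -> bool,
    {in s, forall x, exists2 j, (j <= i)%N & x = (-1) ^+ sigma j *: v j}.
Proof.
elim: i s => [|i IH] s.
  rewrite inE => /eqP ->; exists xpred0 => x; rewrite inE => /eqP ->.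
  by exists 0%N => //; rewrite scale1r.
case/mapP => t tc ->.
have [sigma ht] : exists sigma : nat -> bool,
    {in t, forall x, exists2 j, (j <= i)%N & x = (-1) ^+ sigma j *: v j}.
  move: tc; rewrite mem_cat => /orP[/IH//|/mapP[u /IH[sigma hu] ->]].
  exists (fun j => ~~ sigma j) => _ /mapP[x /hu[j ji ->] ->].
  by exists j; rewrite // signrN scaleNr.
exists (fun j => (j <= i)%N && sigma j) => x; rewrite inE => /orP[/eqP ->|/ht[j ji ->]].
  by exists i.+1; rewrite // ltnn scale1r.
by exists j; [exact: leqW | rewrite ji].
Qed.

End SmallSignChange.

(** * The Borsuk-Ulam theorem *)

Section Compactness.
Variables (R : realType).

Lemma nbhs_norm_ball (V : normedModType R) (x : V) (d : R) : 0 < d ->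
  nbhs x [set y | `|x - y| < d].
Proof. by move=> d0; apply/nbhs_normP; exists d. Qed.

(** Lebesgue number principle: a property of points at scale [e] that holds
    locally for all small [e] holds at a uniform scale. *)
Lemma uniform_on_compact (V : normedModType R) (A : set V) (P : R -> V -> Prop) :
  compact A ->
  (forall x, A x -> exists2 d : R, 0 < d &
     forall y e, A y -> `|x - y| < d -> 0 < e < d -> P e y) ->
  exists2 e : R, 0 < e & forall x, A x -> P e x.
Proof.
move=> /compact_near_coveringP /near_covering_withinP cA locP.
have : \forall e \near 0^'+, A `<=` P e.
  apply: cA => x /locP[d d0 dP].
  exists ([set y | `|x - y| < d], [set e | 0 < e < d]) => /=.
    split; first exact: nbhs_norm_ball.
    near=> e; apply/andP; split; near: e; [exact: nbhs_right_gt|].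
    exact: nbhs_right_lt.
  by move=> [y e] /= [yd ed] Ay; exact: dP.
move=> AP; near (0 : R)^'+ => e; exists e => //.
by near: e.
Unshelve. all: by end_near.
Qed.

Lemma continuous_delta (V W : normedModType R) (h : V -> W) x e : 0 < e ->
  {for x, continuous h} ->
  exists2 d : R, 0 < d & forall y, `|x - y| < d -> `|h x - h y| < e.
Proof.
by move=> e0 /cvgrPdist_lt /(_ e e0) /nbhs_normP[d /= d0 hd]; exists d.
Qed.

End Compactness.

Section BorsukUlam.
Variables (R : realType) (n : nat).
Implicit Types (x y : 'rV[R]_n) (h : 'rV[R]_n -> R).

(** Functions on the sphere are replaced by functions on the punctured space, for
    which continuity is that of the ambient space. *)
Definition odd_map h : Prop :=
  (forall x, x != 0 -> {for x, continuous h}) /\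
  (forall x, x != 0 -> h (- x) = - h x).

Definition basis_vector (j : nat) : 'rV[R]_n := \row_i (i == j :> nat)%:R.

(** An arbitrary choice of one vector in each antipodal pair. *)
Definition lex_pos x : bool :=
  if [pick i | x 0 i != 0] is Some i then 0 < x 0 i else false.

Lemma lex_posN x : x != 0 -> lex_pos (- x) = ~~ lex_pos x.
Proof.
move=> x0; rewrite /lex_pos.
rewrite (@eq_pick _ _ (fun i => x 0 i != 0)); last by move=> i; rewrite mxE oppr_eq0.
case: pickP => [i xi|xz]; first by rewrite mxE oppr_gt0 -leNgt le_eqVlt (negPf xi).
by case/eqP: x0; apply/rowP => i; rewrite mxE; apply/eqP/negbFE/xz.
Qed.

(** Zeros of [h] also get a sign, in such a way that the sign is antisymmetric. *)
Definition pos_sign h x : bool := (0 < h x) || ((h x == 0) && lex_pos x).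

Lemma pos_signN h x : x != 0 -> h (- x) = - h x ->
  pos_sign h (- x) = ~~ pos_sign h x.
Proof.
move=> x0 hN; rewrite /pos_sign hN lex_posN // oppr_gt0 oppr_eq0.
by case: (ltgtP (h x) 0).
Qed.

Lemma pos_sign_near h x : {for x, continuous h} -> h x != 0 ->
  exists2 d : R, 0 < d & forall y, `|x - y| < d -> pos_sign h y = pos_sign h x.
Proof.
move=> hc hx; have hx0 : 0 < `|h x| by rewrite normr_gt0.
have [d d0 hd] := continuous_delta hx0 hc; exists d => // y /hd.
rewrite /pos_sign (negPf hx).
case: (ltgtP 0 (h x)) hx => // [xp|xn] _.
- rewrite (gtr0_norm xp) ltr_distl => /andP[? ?].
  by have -> : 0 < h y by lra.
- rewrite (ltr0_norm xn) ltr_distl => /andP[] ? ?.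
  have yn : h y < 0 by lra.
  by rewrite ltNge ltW // lt_eqF.
Qed.

Lemma all_change_ex (T : eqType) (a : nat -> pred T) i s j :
  all_change a i s -> (j.+1 < size s)%N ->
  exists u w, [/\ u \in s, w \in s & a (i + j)%N u != a (i + j)%N w].
Proof.
elim: s i j => [//|x [|y s] IH] i [|j] //.
  move=> /andP[xy _] _; exists x, y; rewrite addn0.
  by split; rewrite // !inE eqxx ?orbT.
move=> /andP[_ hs] js; have [z [w [zs ws zw]]] := IH _ j hs js.
by exists z, w; rewrite -addSnnS; split; rewrite // inE ?zs ?ws orbT.
Qed.

(* The octahedron lies in this shell, which is compact and avoids 0. *)
Let shell : set 'rV[R]_n := [set x | 1 <= n%:R * `|x| /\ `|x| <= 1].

Lemma compact_shell : compact shell.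
Proof.
apply: bounded_closed_compact.
  exists 1; split => // M M1 x [_ x1]; exact: le_trans x1 (ltW M1).
apply: closedI.
- apply: (@preimage_closed _ _ (fun x : 'rV[R]_n => n%:R * `|x|) [set y | 1 <= y]);
    last exact: closed_ge.
  move=> x _; apply: (@continuousM _ _ (fun=> n%:R) (fun x : 'rV[R]_n => `|x|)).
    exact: cst_continuous.
  exact: norm_continuous.
- apply: (@preimage_closed _ _ (fun x : 'rV[R]_n => `|x|) [set y | y <= 1]);
    last exact: closed_le.
  by move=> x _; exact: norm_continuous.
Qed.

Lemma norm_coord_le x i : `|x 0 i| <= `|x|.
Proof.
by rewrite -[leRHS]/(mx_norm x) mx_normrE; apply/bigmax_geP; right; exists (0, i).
Qed.

Lemma norm_basis_vector j : `|basis_vector j| <= 1.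
Proof.
rewrite -[leLHS]/(mx_norm _) mx_normrE; apply/bigmax_leP; split => // i _.
by rewrite mxE; case: eqP; rewrite ?normr1 ?normr0.
Qed.

(** On each face of the octahedron some form with coefficients 1 and -1 equals
    1, and so it does at all points of the subdivided face; as the form is
    bounded by [n] times the sup norm, these points stay away from 0. *)
Lemma subdivided_hemisphere_shell r i s : (i < n)%N ->
  s \in subdivide_iter r i.+1 (hemisphere basis_vector i) ->
  {in s, forall x, shell x}.
Proof.
move=> i_n.
pose l (sigma : nat -> bool) x := \sum_(j < n) (-1) ^+ sigma j * x 0 j.
pose C (t : seq 'rV[R]_n) x := `|x| <= 1 /\
  forall sigma, {in t, forall y, l sigma y = 1} -> l sigma x = 1.
have l_lin sigma (t : seq 'rV[R]_n) :
    l sigma (barycenter t) = (size t)%:R^-1 * \sum_(x <- t) l sigma x.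
  rewrite /l exchange_big mulr_sumr; apply: eq_bigr => j _.
  by rewrite mxE summxE mulrCA mulr_sumr.
have l_basis sigma j : (j < n)%N -> l sigma ((-1) ^+ sigma j *: basis_vector j) = 1.
  move=> jn; rewrite /l (bigD1 (Ordinal jn)) //= !mxE eqxx mulr1 -expr2 sqrr_sign.
  rewrite big1 ?addr0 // => k kj; rewrite !mxE.
  by rewrite -val_eqE /= in kj; rewrite (negPf kj) !mulr0.
move=> /(subdivide_iter_bary_closed (C := C))[].
- move=> t u u0 Cu; split.
    rewrite -normrN -sub0r; apply: ball_bary_closed => // x /Cu[].
    by rewrite sub0r normrN.
  move=> sigma ht; rewrite l_lin (eq_big_seq (fun=> 1)).
    rewrite big_const_seq count_predT iter_addr_0 mulVf // pnatr_eq0.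
    by case: (u) u0.
  by move=> x xu; have [_] := Cu _ xu; exact.
- exact: size_hemisphere.
- move=> t th x xt; split; last by move=> sigma; exact.
  have [sigma hs] := hemisphere_signs th; have [j _ ->] := hs _ xt.
  by rewrite normrZ normr_sign mul1r norm_basis_vector.
move=> t th Cs x /Cs[x1 lx]; split => //.
have [sigma hs] := hemisphere_signs th.
have lx1 : l sigma x = 1.
  by apply: lx => y /hs[j ji ->]; rewrite l_basis // (leq_ltn_trans ji).
rewrite -[leLHS]lx1.
have -> : n%:R * `|x| = \sum_(j < n) `|x| by rewrite sumr_const card_ord mulr_natl.
apply: ler_sum => j _.
by rewrite (le_trans (ler_norm _)) // normrM normr_sign mul1r norm_coord_le.
Qed.

Lemma shell_neq0 x : shell x -> x != 0.
Proof. by move=> [x1 _]; apply: contraTneq x1 => ->; rewrite normr0 mulr0 ler10. Qed.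

(** Without common zero, near each point some [h j] has a constant sign. By
    compactness no simplex smaller than some [e > 0] has a sign change of every
    [h j], while a fine subdivision of the hemisphere contains one. *)
Theorem borsuk_ulam D (h : 'I_D -> 'rV[R]_n -> R) : (D < n)%N ->
  (forall j, odd_map (h j)) -> exists2 x, x != 0 & forall j, h j x = 0.
Proof.
move=> Dn hodd; apply: contrapT => no_zero.
have nz x : x != 0 -> exists j, h j x != 0.
  move=> x0; apply: contrapT => hx; apply: no_zero; exists x => // j.
  by apply/eqP/negPn/negP => hj; apply: hx; exists j.
(* For [j >= D] any antisymmetric value will do: a simplex of dimension [D] only
   sees the signs of index less than [D]. *)
pose a j x := if insub j is Some j' then pos_sign (h j') x else lex_pos x.
have aN j x : x != 0 -> a j (- x) = ~~ a j x.
  move=> x0; rewrite /a; case: insub => [j'|]; last exact: lex_posN.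
  by apply: pos_signN => //; exact: (hodd j').2.
pose P e x := forall s, size s = D.+1 -> {in s, forall y, `|x - y| <= e} ->
  ~~ all_change a 0 s.
have [e e0 eP] : exists2 e : R, 0 < e & forall x, shell x -> P e x.
  apply: uniform_on_compact; first exact: compact_shell.
  move=> x /shell_neq0 x0; have [j hj] := nz x x0.
  have [d d0 hd] := pos_sign_near ((hodd j).1 x x0) hj.
  exists (d / 2) => [|y e _ xy /andP[e0 ed] s sz ye]; first by rewrite divr_gt0.
  apply/negP => /(all_change_ex (j := j))[|u [w [us ws]]]; first by rewrite sz ltnS.
  rewrite add0n /a valK; suff xz z : z \in s -> `|x - z| < d.
    by rewrite (hd u (xz u us)) (hd w (xz w ws)) eqxx.
  move=> /ye yz; rewrite -(subrKA y) (le_lt_trans (ler_normD _ _)) //; lra.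
pose q : R := D%:R / D.+1%:R.
have q0 : 0 <= q by rewrite divr_ge0.
have q1 : `|q| < 1 by rewrite ger0_norm // ltr_pdivrMr ?ltr0n // mul1r ltr_nat.
have [r rP] : exists r, q ^+ r * 2 <= e.
  have /cvgrPdist_lt /(_ _ e0)[r _ /(_ r (leqnn r))] := cvg_geometric 2 q1.
  rewrite /= sub0r normrN mulrC ger0_norm; last by rewrite mulr_ge0 ?exprn_ge0.
  by move/ltW => ?; exists r.
have : parity (all_change a 0) (subdivide_iter r D.+1 (hemisphere basis_vector D)).
  apply: parity_all_change => j s jD sj x xs l; apply: aN; apply: shell_neq0.
  by apply: subdivided_hemisphere_shell sj _ xs; exact: leq_ltn_trans Dn.
rewrite /parity => /odd_gt0; rewrite -has_count => /hasP[s sr hs].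
have sz := size_subdivide_iter (@size_hemisphere _ _ basis_vector D) sr.
have small : diam_le e s.
  have hdiam t : t \in hemisphere basis_vector D -> diam_le 2 t.
    move=> /hemisphere_signs[sigma ht] x y /ht[j _ ->] /ht[k _ ->].
    rewrite (le_trans (ler_normB _ _)) // !normrZ !normr_sign !mul1r.
    by rewrite -[2]/(1 + 1) lerD ?norm_basis_vector.
  have := diam_subdivide_iter _ (ltn0Sn D) (@size_hemisphere _ _ _ D) hdiam sr.
  move=> /(_ (ler0n _ 2)) hx x y xs ys; exact: le_trans (hx x y xs ys) rP.
case: s sz hs small sr => [//|x s] sz hs small sr.
have xs : x \in x :: s by exact: mem_head.
suff /negP : ~~ all_change a 0 (x :: s) by apply.
apply: (eP x) => // [|y]; first exact: subdivided_hemisphere_shell Dn sr _ xs.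
exact: small.
Qed.

End BorsukUlam.

(** * The genus of a compact set and of the fibres of an even function *)

Section Genus.
Variables (R : realType) (n : nat).
Implicit Types (x y : 'rV[R]_n) (g h : 'rV[R]_n -> R) (A B : set 'rV[R]_n).

Definition even_map g : Prop :=
  (forall x, x != 0 -> {for x, continuous g}) /\
  (forall x, x != 0 -> g (- x) = g x).

(** For a closed symmetric set this says that its Krasnoselskii genus is at most
    [D], by the Tietze extension theorem. *)
Definition genus_le (D : nat) A : Prop :=
  exists h : 'I_D -> 'rV[R]_n -> R,
    (forall j, odd_map (h j)) /\ forall x, A x -> exists j, h j x != 0.

Lemma odd_map0 : odd_map (fun _ : 'rV[R]_n => 0 : R).
Proof.
by split=> [x _|x _]; [exact: cst_continuous|rewrite oppr0].
Qed.

Lemma odd_mapD h1 h2 : odd_map h1 -> odd_map h2 ->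
  odd_map (fun x => h1 x + h2 x).
Proof.
move=> [c1 o1] [c2 o2]; split=> x x0.
  by apply: (@continuousD _ _ _ h1 h2); [exact: c1|exact: c2].
by rewrite o1 // o2 // opprD.
Qed.

Lemma odd_map_sum (I : Type) (r : seq I) (P : pred I) (F : I -> 'rV[R]_n -> R) :
  (forall i, odd_map (F i)) -> odd_map (fun x => \sum_(i <- r | P i) F i x).
Proof.
move=> oF; elim: r => [|i r IH].
  by under eq_fun do rewrite big_nil; exact: odd_map0.
under eq_fun do rewrite big_cons; case: (P i) => //.
exact: odd_mapD.
Qed.

Lemma odd_mapM g h : even_map g -> odd_map h -> odd_map (fun x => g x * h x).
Proof.
move=> [c1 e1] [c2 o2]; split=> x x0.
  by apply: (@continuousM _ _ g h); [exact: c1|exact: c2].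
by rewrite e1 // o2 // mulrN.
Qed.

(** Twice the positive part of [w - |t|]. *)
Definition tent (w t : R) : R := (w - `|t|) + `|w - `|t| |.

Lemma tent_gt0 w t : `|t| < w -> 0 < tent w t.
Proof. by move=> tw; rewrite ltr_pwDl ?subr_gt0. Qed.

Lemma tent_eq0 w t : w <= `|t| -> tent w t = 0.
Proof. by move=> tw; rewrite /tent [`|w - _|]ler0_norm ?subrr // subr_le0. Qed.

Lemma even_map_tent g w c : even_map g -> even_map (fun x => tent w (g x - c)).
Proof.
move=> [gc ge]; split=> x x0; last by rewrite ge.
have c1 : {for x, continuous (fun y => w - `|g y - c|)}.
  apply: (@continuousB _ _ _ (fun=> w) (fun y => `|g y - c|)).
    exact: cst_continuous.
  apply: (@continuous_comp _ _ _ (fun y => g y - c) Num.norm).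
    apply: (@continuousB _ _ _ g (fun=> c)); [exact: gc|exact: cst_continuous].
  exact: norm_continuous.
apply: (@continuousD _ _ _ (fun y => w - `|g y - c|)
  (fun y => `|w - `|g y - c| |)) => //.
apply: (@continuous_comp _ _ _ (fun y => w - `|g y - c|) Num.norm) => //.
exact: norm_continuous.
Qed.

Lemma genus_le_sub D A B : A `<=` B -> genus_le D B -> genus_le D A.
Proof. by move=> AB [h [ho hB]]; exists h; split => // x /AB/hB. Qed.

(** The points where some [h j] is not zero form a neighbourhood of the fibre,
    which contains a slab by compactness. *)
Lemma genus_le_fibre_nbhs D A g x : compact A -> (forall y, A y -> y != 0) ->
  even_map g -> A x -> genus_le D (A `&` [set y | g y = g x]) ->
  exists2 e : R, 0 < e & genus_le D (A `&` [set y | `|g x - g y| < e]).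
Proof.
move=> cA A0 [gc _] Ax [h [ho hA]].
have [e e0 eP] : exists2 e : R, 0 < e &
    forall y, A y -> `|g x - g y| < e -> exists j, h j y != 0.
  apply: (uniform_on_compact (P := fun e y =>
    `|g x - g y| < e -> exists j, h j y != 0)) => // y Ay.
  have [gxy|gxy] := eqVneq (g y) (g x).
    have [j hj] := hA y (conj Ay gxy).
    have hj0 : 0 < `|h j y| by rewrite normr_gt0.
    have [d d0 dP] := continuous_delta hj0 ((ho j).1 y (A0 y Ay)).
    exists d => // z e _ /dP zy _ _; exists j.
    by apply: contraTneq zy => ->; rewrite subr0 ltxx.
  have c0 : 0 < `|g x - g y| / 2 by rewrite divr_gt0 // normr_gt0 subr_eq0 eq_sym.
  have [d d0 dP] := continuous_delta c0 (gc y (A0 y Ay)).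
  exists (Num.min d (`|g x - g y| / 2)); first by rewrite lt_min d0.
  move=> z e _; rewrite !lt_min => /andP[/dP gyz _] /and3P[_ _ eg] gxz.
  have := ler_distD (g z) (g x) (g y).
  rewrite (distrC (g z)) => ?; exfalso; lra.
by exists e => //; exists h; split => // y [] Ay; exact: eP.
Qed.

(** The width of the slab is made independent of its centre, at the price of
    halving it. *)
Lemma genus_le_slabs D A g : compact A -> (forall y, A y -> y != 0) ->
  even_map g -> (forall c, genus_le D (A `&` [set y | g y = c])) ->
  exists2 e : R, 0 < e &
    forall x, A x -> genus_le D (A `&` [set y | `|g x - g y| < e]).
Proof.
move=> cA A0 ge hfib; apply: uniform_on_compact => // x Ax.
have [e e0 he] := genus_le_fibre_nbhs cA A0 ge Ax (hfib (g x)).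
have e20 : 0 < e / 2 by rewrite divr_gt0.
have [d d0 dP] := continuous_delta e20 (ge.1 x (A0 x Ax)).
exists (Num.min d (e / 2)); first by rewrite lt_min d0.
move=> y e' _; rewrite !lt_min => /andP[/dP gxy _] /and3P[_ _ e'e].
apply: genus_le_sub he => z [Az /= gyz]; split => //=.
have := ler_distD (g y) (g x) (g z); lra.
Qed.

Lemma bounded_on_compact A g : compact A -> (forall y, A y -> y != 0) ->
  even_map g -> exists M : R, forall x, A x -> `|g x| <= M.
Proof.
move=> cA A0 [gc _].
have [e e0 eP] : exists2 e : R, 0 < e & forall x, A x -> `|g x| * e <= 1.
  apply: (uniform_on_compact (P := fun e x => `|g x| * e <= 1)) => // x Ax.
  have [d d0 dP] := continuous_delta ltr01 (gc x (A0 x Ax)).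
  have gx1 : 0 < `|g x| + 1 by rewrite ltr_wpDl.
  exists (Num.min d (`|g x| + 1)^-1); first by rewrite lt_min d0 invr_gt0.
  move=> y e _; rewrite !lt_min => /andP[/dP gxy _] /and3P[e0 _ eg].
  have gy : `|g y| <= `|g x| + 1.
    have := lerB_dist (g y) (g x); rewrite distrC; lra.
  rewrite (le_trans (ler_wpM2r (ltW e0) gy)) //.
  by rewrite -ler_pdivlMl // mulr1 ltW.
by exists e^-1 => x /eP; rewrite -[_^-1]mul1r ler_pdivlMr.
Qed.

Lemma same_parity_dist (i k : nat) : odd k = odd i -> k != i ->
  2 <= `|i%:R - k%:R| :> R.
Proof.
wlog ik : i k / (i < k)%N => [hw oik ki|oik _].
  case: (ltngtP i k) => ik; [exact: hw|rewrite distrC|by rewrite ik eqxx in ki].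
  by apply: hw => //; rewrite eq_sym.
rewrite distrC -natrB ?normr_nat ?ler_nat; lia.
Qed.

(** The slabs around the values [c i], of half-width [w], cover [A]. Those with
    the same parity of [i] are disjoint, so at each point of such a slab the sum
    [S] of that parity reduces to a single term, which for some [j] is not
    zero. *)
Lemma genus_le_double D A g : compact A -> (forall y, A y -> y != 0) ->
  even_map g -> (forall c, genus_le D (A `&` [set y | g y = c])) ->
  genus_le (D + D) A.
Proof.
move=> cA A0 ge hfib.
have [e e0 he] := genus_le_slabs cA A0 ge hfib.
have [M hM] := bounded_on_compact cA A0 ge.
(* A slab of half-width [w] that meets [A] at [x] lies within [e = 2 w] of
   [g x], although its centre need not be a value of [g]. *)
pose w := e / 2; have w0 : 0 < w by rewrite divr_gt0.
(* The shift by [L] lets the indices of the slabs be natural numbers. *)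
pose L := (Num.truncn (M / w)).+1.
pose c (i : nat) : R := (i%:R - L%:R) * w.
have /choice[H HP] : forall i : nat, exists h : 'I_D -> 'rV[R]_n -> R,
    (forall j, odd_map (h j)) /\
    forall y, A y -> `|g y - c i| < w -> exists j, h j y != 0.
  move=> i; have [[x [Ax xi]]|none] := pselect (exists x, A x /\ `|g x - c i| < w).
    have [h [ho hA]] := he x Ax; exists h; split => // y Ay yi; apply: hA.
    split => //=; have := ler_distD (c i) (g x) (g y).
    rewrite (distrC (c i)); rewrite /w in xi yi; lra.
  exists (fun _ _ => 0); split=> [j|y Ay yi]; first exact: odd_map0.
  by case: none; exists y.
pose S (b : bool) (j : 'I_D) x : R :=
  \sum_(i < (L + L)%N | odd i == b) tent w (g x - c i) * H i j x.
have So b j : odd_map (S b j).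
  apply: odd_map_sum => i; apply: odd_mapM; first exact: even_map_tent.
  exact: (HP i).1.
exists (fun k => match split k with inl j => S false j | inr j => S true j end).
split=> [k|x Ax]; first by case: (split k).
have [i iL xi] : exists2 i, (i < L + L)%N & `|g x - c i| < w.
  pose t := g x / w + L%:R.
  have gx : `|g x / w| < L%:R.
    rewrite normrM normfV (gtr0_norm w0); apply: le_lt_trans (truncnS_gt _).
    by rewrite ler_pM2r ?invr_gt0 // hM.
  move: gx; rewrite ltr_norml => /andP[gx1 gx2].
  have t0 : 0 <= t by rewrite /t; lra.
  have /andP[t1 t2] := truncn_itv t0.
  exists (Num.truncn t).
    rewrite -(ltr_nat R) (le_lt_trans t1) // natrD /t; lra.
  have -> : g x - c (Num.truncn t) = (t - (Num.truncn t)%:R) * w.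
    by rewrite /c /t; field; rewrite gt_eqF.
  rewrite normrM (gtr0_norm w0) gtr_pMl // ger0_norm ?subr_ge0 //.
  rewrite -natr1 in t2; lra.
have [j hj] := (HP i).2 x Ax xi.
exists (unsplit (if odd i then inr j else inl j)); rewrite unsplitK.
suff : S (odd i) j x != 0 by case: (odd i).
rewrite /S (bigD1 (Ordinal iL)) //= big1 ?addr0; last first.
  move=> k /andP[/eqP ki]; rewrite -val_eqE /= => kni.
  rewrite tent_eq0 ?mul0r //.
  have : 2 * w <= `|c i - c k|.
    rewrite /c -mulrBl normrM (gtr0_norm w0) ler_pM2r //.
    have -> : i%:R - L%:R - (k%:R - L%:R) = (i%:R - k%:R) :> R by ring.
    exact: same_parity_dist.
  have := ler_distD (g x) (c i) (c k); rewrite (distrC (c i) (g x)); lra.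
by rewrite mulf_neq0 // gt_eqF // tent_gt0.
Qed.

Lemma compact_fibre A g c : compact A -> (forall y, A y -> y != 0) ->
  even_map g -> compact (A `&` [set y | g y = c]).
Proof.
move=> /compact_near_coveringP/near_covering_withinP cA A0 [gc _].
apply/compact_near_coveringP/near_covering_withinP => I F P FF hP.
suff : \near F, A `<=` (fun i y => g y = c -> P i y) F.
  by apply: filter_app; near=> i => Ai y [Ay gy]; exact: Ai.
apply: cA => x Ax; have [gx|gx] := eqVneq (g x) c.
  by apply: filter_app (hP x (conj Ax gx)); near=> i => + Ay gy; apply; split.
have gx0 : 0 < `|g x - c| by rewrite normr_gt0 subr_eq0.
have [d d0 dP] := continuous_delta gx0 (gc x (A0 x Ax)).
have xd : nbhs x [set y | `|x - y| < d] by exact: nbhs_norm_ball.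
exists ([set y | `|x - y| < d], setT); last first.
  by move=> [y i] /= [/dP + _] _ gy; rewrite gy ltxx.
split=> //; exact: filterT.
Unshelve. all: by end_near.
Qed.

(** The functions are peeled off one at a time, the genus doubling each time. *)
Lemma genus_le_fibres D m (g : nat -> 'rV[R]_n -> R) A :
  compact A -> (forall y, A y -> y != 0) -> (forall l, even_map (g l)) ->
  (forall c : nat -> R,
     genus_le D (A `&` [set y | forall l, (l < m)%N -> g l y = c l])) ->
  genus_le (2 ^ m * D) A.
Proof.
move=> + + ge; elim: m A => [|m IH] A cA A0 hfib.
  by rewrite mul1n; apply: genus_le_sub (hfib (fun=> 0)) => x Ax.
rewrite expnS -mulnA mul2n -addnn; apply: (genus_le_double (g := g m)) => // c.
apply: IH => [|y [Ay _]|c']; [exact: compact_fibre|exact: A0|].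
apply: genus_le_sub (hfib (fun l => if l == m then c else c' l)).
move=> y [[Ay /= gm] gl]; split => // l; rewrite ltnS leq_eqVlt.
by case: eqP => [->//|_] /= /gl.
Qed.

Lemma genus_le_zero D A (I : finType) (h : I -> 'rV[R]_n -> R) :
  ~ genus_le D A -> (#|I| <= D)%N -> (forall i, odd_map (h i)) ->
  exists2 x, A x & forall i, h i x = 0.
Proof.
move=> gA ID ho; apply: contrapT => nz; apply: gA.
exists (fun j : 'I_D => if insub (j : nat) is Some i then h (enum_val (i : 'I_#|I|))
  else fun=> 0); split=> [j|x Ax].
  by case: insub => [i|]; [exact: ho|exact: odd_map0].
apply: contrapT => hx; apply: nz; exists x => // i; apply/eqP/negPn/negP => hi.
apply: hx; exists (widen_ord ID (enum_rank i)).
by rewrite /= (valK (enum_rank i)) enum_rankK.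
Qed.

End Genus.

(** * The Euclidean sphere *)

Section Sphere.
Variables (R : realType) (n : nat).
Implicit Types (x y : 'rV[R]_n).

Lemma continuous_dotp (T : topologicalType) (u v : T -> 'rV[R]_n) (t : T) :
  {for t, continuous u} -> {for t, continuous v} ->
  {for t, continuous (fun s => dotp (u s) (v s))}.
Proof.
move=> uc vc; rewrite /dotp.
suff ind (r : seq 'I_n) : {for t, continuous (fun s : T => \sum_(i <- r) u s 0 i * v s 0 i)}.
  exact: ind.
elim: r => [|i r IH].
  rewrite (_ : (fun s => _) = fun=> 0); first exact: cst_continuous.
  by apply/funext => s; rewrite big_nil.
pose F := fun s => \sum_(j <- r) u s 0 j * v s 0 j.
rewrite (_ : (fun s => _) = fun s => u s 0 i * v s 0 i + F s); last first.
  by apply/funext => s; rewrite big_cons.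
apply: (@continuousD _ _ _ (fun s => u s 0 i * v s 0 i) F) => //.
apply: (@continuousM _ _ (fun s => u s 0 i) (fun s => v s 0 i)).
  by apply: (continuous_comp (g := fun M : 'rV[R]_n => M 0 i)) => //; exact: coord_continuous.
by apply: (continuous_comp (g := fun M : 'rV[R]_n => M 0 i)) => //; exact: coord_continuous.
Qed.

Lemma dotp_ge0 x : 0 <= dotp x x.
Proof. by apply: sumr_ge0 => i _; rewrite -expr2 sqr_ge0. Qed.

Lemma enorm_gt0 x : x != 0 -> 0 < enorm x.
Proof.
move=> x0; rewrite sqrtr_gt0 lt_neqAle dotp_ge0 andbT eq_sym.
apply: contra x0; rewrite psumr_eq0; last by move=> i _; rewrite -expr2 sqr_ge0.
move=> /allP xz; apply/eqP/rowP => i; rewrite mxE.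
by have := xz i (mem_index_enum i); rewrite mulf_eq0 orbb => /eqP.
Qed.

Lemma enormZ (a : R) x : enorm (a *: x) = `|a| * enorm x.
Proof.
rewrite /enorm -sqrtr_sqr -sqrtrM ?sqr_ge0 //; congr Num.sqrt.
rewrite /dotp mulr_sumr; apply: eq_bigr => i _; rewrite !mxE; ring.
Qed.

Lemma sphere_dotp x : sphere x -> dotp x x = 1.
Proof. by move=> x1; rewrite -(sqr_sqrtr (dotp_ge0 x)) -/(enorm x) x1 expr1n. Qed.

Lemma sphere_neq0 x : sphere x -> x != 0.
Proof.
move=> /sphere_dotp x1; apply: contra_eqN x1 => /eqP ->.
by rewrite /dotp big1 ?(eq_sym 0) ?oner_eq0 // => i _; rewrite mxE mul0r.
Qed.

Lemma continuous_enorm : continuous (@enorm R n).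
Proof.
move=> x; apply: (@continuous_comp _ _ _ (fun y => dotp y y) Num.sqrt).
  by apply: (@continuous_dotp _ id id) => y; exact: cvg_id.
exact: sqrt_continuous.
Qed.

Lemma compact_sphere : compact (@sphere R n).
Proof.
apply: bounded_closed_compact.
  exists 1; split => // M M1 x /sphere_dotp x1; apply: le_trans (ltW M1).
  rewrite -[leLHS]/(mx_norm x) mx_normrE; apply/bigmax_leP; split => // -[j i] _.
  rewrite (ord1 j) /= -(@ler_pXn2r _ 2) ?nnegrE // expr1n -normrX ger0_norm ?sqr_ge0 //.
  rewrite -x1 /dotp (bigD1 i) //= -expr2 lerDl.
  by apply: sumr_ge0 => k _; rewrite -expr2 sqr_ge0.
apply: (@preimage_closed _ _ (@enorm R n) [set 1]); last exact: closed_eq.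
by move=> x _; exact: continuous_enorm.
Qed.

Definition unit_vector x : 'rV[R]_n := (enorm x)^-1 *: x.

Lemma sphere_unit_vector x : x != 0 -> sphere (unit_vector x).
Proof.
move=> /enorm_gt0 x0; rewrite /sphere /= /unit_vector enormZ.
by rewrite ger0_norm ?invr_ge0 ?mulVf ?gt_eqF // ltW.
Qed.

Lemma unit_vector_id x : sphere x -> unit_vector x = x.
Proof. by rewrite /sphere /= /unit_vector => ->; rewrite invr1 scale1r. Qed.

Lemma unit_vectorN x : unit_vector (- x) = - unit_vector x.
Proof. by rewrite /unit_vector -scaleN1r enormZ normrN1 mul1r scaleN1r scalerN. Qed.

Lemma continuous_unit_vector x : x != 0 -> {for x, continuous unit_vector}.
Proof.
move=> /enorm_gt0 x0.
apply: (@continuousZ _ _ _ (fun y => (enorm y)^-1) id).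
  by apply: continuousV; [rewrite gt_eqF|exact: continuous_enorm].
by move=> y; exact: cvg_id.
Qed.

Lemma sphereN x : sphere x -> sphere (- x).
Proof. by rewrite /sphere /= -scaleN1r enormZ normrN1 mul1r. Qed.

(** Radial projection turns continuity within the sphere into continuity on the
    punctured space. *)
Lemma continuous_within_comp (U : topologicalType) (B : set U) (f : U -> R)
    (phi : 'rV[R]_n -> U) x :
  {within B, continuous f} -> x != 0 -> (forall y, y != 0 -> B (phi y)) ->
  {for x, continuous phi} -> {for x, continuous (f \o phi)}.
Proof.
move=> /subspace_continuousP fc x0 Bphi phic W /(fc _ (Bphi x x0)) /= Wf.
suff : nbhs x ((f \o phi) @^-1` W) by [].
have nx0 : 0 < `|x| by rewrite normr_gt0.
have phiW : nbhs x (phi @^-1` [set y | B y -> W (f y)]) := phic _ Wf.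
apply: filterS2 phiW (nbhs_norm_ball x nx0) => y + /= xy; apply; apply: Bphi.
by apply: contraTneq xy => ->; rewrite subr0 ltxx.
Qed.

Lemma continuous_pair (T U V : topologicalType) (u : T -> U) (v : T -> V) (t : T) :
  {for t, continuous u} -> {for t, continuous v} ->
  {for t, continuous (fun s => (u s, v s))}.
Proof. by move=> uc vc; apply: cvg_pair. Qed.

Lemma odd_map_bifun (f : 'rV[R]_n * 'rV[R]_n -> R) e : odd_bifun f -> sphere e ->
  odd_map (fun y => f (e, unit_vector y)).
Proof.
move=> [fc _ fo] es; split=> x x0; last first.
  by rewrite unit_vectorN fo //; exact: sphere_unit_vector.
apply: (continuous_within_comp (phi := fun y => (e, unit_vector y)) fc) => //.
  by move=> y /sphere_unit_vector.
apply: continuous_pair; [exact: cst_continuous|exact: continuous_unit_vector].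
Qed.

Lemma even_map_diagonal (f : 'rV[R]_n * 'rV[R]_n -> R) : odd_bifun f ->
  even_map (fun y => f (unit_vector y, unit_vector y)).
Proof.
move=> [fc fo1 fo2]; split=> x x0; last first.
  have xs := sphere_unit_vector x0.
  by rewrite unit_vectorN fo1 ?fo2 ?opprK //; exact: sphereN.
apply: (continuous_within_comp (phi := fun y => (unit_vector y, unit_vector y)) fc) => //.
  by move=> y /sphere_unit_vector.
by apply: continuous_pair; exact: continuous_unit_vector.
Qed.

Lemma odd_map_dotp (e : 'rV[R]_n) : odd_map (dotp e).
Proof.
split=> x _.
  apply: (@continuous_dotp _ (fun=> e) id); first exact: cst_continuous.
  by move=> y; exact: cvg_id.
by rewrite /dotp -sumrN; apply: eq_bigr => i _; rewrite mxE mulrN.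
Qed.

(** * Choosing the frame in a set that few odd functions cannot separate *)

Lemma genus_sphere D : (D < n)%N -> ~ genus_le D (@sphere R n).
Proof.
move=> Dn [h [ho hS]].
have ho' j : odd_map (h j \o unit_vector).
  have [hc hN] := ho j; split=> x x0; have ux := sphere_neq0 (sphere_unit_vector x0).
    by apply: continuous_comp; [exact: continuous_unit_vector|exact: hc].
  by rewrite /= unit_vectorN hN.
have [x x0 hx] := borsuk_ulam Dn ho'.
have [j] := hS _ (sphere_unit_vector x0).
by have /= -> := hx j; rewrite eqxx.
Qed.

(** Greedy choice: the next vector is a common zero in [A] of odd functions
    determined by the previous ones. The family is indexed by all of
    ['I_k * option 'I_m], of cardinal [k * m.+1], and completed by zero
    functions. *)
Lemma orthogonal_zeros (k m : nat) (f : 'I_m -> 'rV[R]_n * 'rV[R]_n -> R)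
    (A : set 'rV[R]_n) :
  (forall l, odd_bifun (f l)) -> A `<=` @sphere R n ->
  ~ genus_le (k * m.+1) A ->
  exists e : nat -> 'rV[R]_n, (forall i, (i < k)%N -> A (e i)) /\
    forall i j, (i < j < k)%N ->
      dotp (e i) (e j) = 0 /\ forall l, f l (e i, e j) = 0.
Proof.
move=> fo AS gA; suff ind j : (j <= k)%N ->
  exists e : nat -> 'rV[R]_n, (forall i, (i < j)%N -> A (e i)) /\
    forall i i', (i < i' < j)%N ->
      dotp (e i) (e i') = 0 /\ forall l, f l (e i, e i') = 0 by exact: ind.
elim: j => [_|j IH jk]; first by exists (fun=> 0); split=> // i i'; rewrite ltn0 andbF.
have [e [eA eo]] := IH (ltnW jk).
pose h (p : 'I_k * option 'I_m) x : R := if (p.1 < j)%N then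
  if p.2 is Some l then f l (e p.1, unit_vector x) else dotp (e p.1) x else 0.
have ho p : odd_map (h p).
  rewrite /h; case: ltnP => [pj|_]; last exact: odd_map0.
  case: p.2 => [l|]; last exact: odd_map_dotp.
  by apply: odd_map_bifun => //; exact/AS/eA.
have [|x Ax hx] := genus_le_zero gA _ ho.
  by rewrite card_prod card_option !card_ord.
exists (fun i => if i == j then x else e i); split=> [i|i i' /andP[ii' i'j]].
  by rewrite ltnS leq_eqVlt; case: eqP => //= _; exact: eA.
have ij : (i < j)%N by rewrite (leq_trans ii').
rewrite (ltn_eqF ij); move: i'j; rewrite ltnS leq_eqVlt.
case: eqP => [i'j _|_ /= i'j]; last by apply: eo; rewrite ii'.
pose i0 := Ordinal (ltn_trans ij jk).
split=> [|l].
  by have := hx (i0, None); rewrite /h /= ij.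
by have := hx (i0, Some l); rewrite /h /= ij (unit_vector_id (AS _ Ax)).
Qed.

End Sphere.

Theorem theorem7 (R : realType) :
  exists N : nat -> nat -> nat,
    forall k m : nat, (0 < k)%N -> (0 < m)%N ->
      (0 < N k m)%N /\
      forall n : nat, (N k m <= n)%N ->
      forall f : 'I_m -> 'rV[R]_n * 'rV[R]_n -> R,
        (forall l, odd_bifun (f l)) ->
        exists e : 'I_k -> 'rV[R]_n,
          orthonormal_frame e /\
          forall l : 'I_m,
            (forall i j : 'I_k, (i < j)%N -> f l (e i, e j) = 0) /\
            (forall i j : 'I_k, f l (e i, e i) = f l (e j, e j)).
Proof.
exists (fun k m => (2 ^ m * (k * m.+1)).+1) => k m _ _; split=> // n nN f fo.
pose g (l : nat) y :=
  if insub l is Some l' then f l' (unit_vector y, unit_vector y) else 0.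
have ge l : even_map (g l).
  rewrite /g; case: insub => [l'|]; first exact: even_map_diagonal.
  by split=> // x _; exact: cst_continuous.
pose A c := @sphere R n `&` [set y | forall l, (l < m)%N -> g l y = c l].
have [c gA] : exists c, ~ genus_le (k * m.+1) (A c).
  apply: contrapT => noc; apply: (genus_sphere nN).
  apply: (genus_le_fibres (g := g)) => // [||c]; first exact: compact_sphere.
    by move=> y; exact: sphere_neq0.
  by apply: contrapT => gA; apply: noc; exists c.
have AS : A c `<=` @sphere R n by move=> x [].
have [e [eA eo]] := orthogonal_zeros fo AS gA.
exists (fun i : 'I_k => e i); split=> [i j|l].
  have [ij|ji|ij] := ltngtP i j.
  - by rewrite (eo i j _).1 ?ij ?ltn_ord // -val_eqE /= ltn_eqF.
  - rewrite /dotp; under eq_bigr do rewrite mulrC.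
    by rewrite -/(dotp _ _) (eo j i _).1 ?ji ?ltn_ord // -val_eqE /= gtn_eqF.
  - by rewrite (ord_inj ij) eqxx; apply: sphere_dotp; exact/AS/eA.
split=> i j; first by move=> ij; apply: (eo i j _).2; rewrite ij ltn_ord.
have diag (p : 'I_k) : f l (e p, e p) = c l.
  have [es ec] := eA p (ltn_ord p).
  by rewrite -(ec l (ltn_ord l)) /g valK unit_vector_id.
by rewrite !diag.
Qed.
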